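(* There exist finite groups $G$ of central type such that $H^2(G,\mathbb{C}^* )$ admits more than one $\mathrm{Aut}(G)$-orbit of non-degenerate cohomology classes.
   Context: For a finite group $G$ and a 2-cocycle $f\in Z^2(G,\mathbb{C}^* )$ (trivial action of $G$ on $\mathbb{C}^*$), the twisted group algebra $\mathbb{C}^fG$ is the $\mathbb{C}$-algebra with basis $\{u_g\}_{g\in G}$ and multiplication $u_{g}u_{h}=f(g,h)u_{gh}$. The cocycle $f$ (equivalently its class $[f]\in H^2(G,\mathbb{C}^* )$) is non-degenerate if $\mathbb{C}^fG$ is isomorphic to a matrix algebra over $\mathbb{C}$ (i.e. is simple). A finite group $G$ is of central type if it admits a non-degenerate 2-cocycle. The group $\mathrm{Aut}(G)$ acts on $H^2(G,\mathbb{C}^* )$ by $\phi([f])=[\phi(f)]$, $\phi(f)(g_1,g_2)=f(\phi^{-1}(g_1),\phi^{-1}(g_2))$; this action preserves the subset of non-degenerate classes. *)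

(* Defs.v *)
From HB Require Import structures.
From mathcomp Require Import all_boot all_order all_algebra all_fingroup.
From mathcomp Require Import generic_quotient boolp classical_sets reals.
From mathcomp Require Export complex.

Set Implicit Arguments.
Unset Strict Implicit.
Unset Printing Implicit Defensive.

Import GRing.Theory.
Local Open Scope ring_scope.
Local Open Scope quotient_scope.

(* Second cohomology of a finite group with values in the multiplicative group
   F^* of a field, with trivial action. Elements of F^* are represented as
   nonzero elements of F. Cocycles are not assumed to be normalised. *)

Record cocycle (F : fieldType) (gT : finGroupType) := Cocycle {
  cocycle_fun :> gT -> gT -> F;
  cocycle_neq0 : forall g h, cocycle_fun g h != 0;
  cocycleP : forall g h k,
    cocycle_fun g h * cocycle_fun (g * h)%g k
      = cocycle_fun g (h * k)%g * cocycle_fun h k }.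

HB.instance Definition _ (F : fieldType) (gT : finGroupType) :=
  gen_eqMixin (cocycle F gT).
HB.instance Definition _ (F : fieldType) (gT : finGroupType) :=
  gen_choiceMixin (cocycle F gT).

Section TwistedGroupAlgebra.
Variables (F : fieldType) (gT : finGroupType).

(* The vector space of functions gT -> F, without its pointwise product; the
   product below depends on f. *)
Definition twisted_alg (f : cocycle F gT) : Type := {ffun gT -> F^o}.

HB.instance Definition _ (f : cocycle F gT) :=
  GRing.Lmodule.copy (twisted_alg f) {ffun gT -> F^o}.

Variable f : cocycle F gT.
Local Notation A := (twisted_alg f).

Definition tw_basis (g : gT) : A := [ffun h => (h == g)%:R : F].
Local Notation u := tw_basis.

Definition tw_one : A := (f 1%g 1%g)^-1 *: u 1%g.

Definition tw_mul (x y : A) : A :=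
  \sum_g \sum_h (x g * y h * f g h) *: u (g * h)%g.

Lemma tw_decomp (x : A) : x = \sum_g x g *: u g.
Proof.
apply/ffunP => h; rewrite sum_ffunE (bigD1 h) //= big1 ?addr0.
  by rewrite !ffunE eqxx /GRing.scale /= mulr1.
by move=> i ih; rewrite !ffunE eq_sym (negPf ih) /GRing.scale /= mulr0.
Qed.

Lemma tw_mulDl : left_distributive tw_mul +%R.
Proof.
move=> x y z; rewrite /tw_mul -big_split; apply: eq_bigr => g _.
rewrite -big_split; apply: eq_bigr => h _ /=.
by rewrite ffunE !mulrDl scalerDl.
Qed.

Lemma tw_mulDr : right_distributive tw_mul +%R.
Proof.
move=> x y z; rewrite /tw_mul -big_split; apply: eq_bigr => g _.
rewrite -big_split; apply: eq_bigr => h _ /=.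
by rewrite ffunE mulrDr mulrDl scalerDl.
Qed.

Lemma tw_mulZl a (x y : A) : a *: tw_mul x y = tw_mul (a *: x) y.
Proof.
rewrite /tw_mul scaler_sumr; apply: eq_bigr => g _.
rewrite scaler_sumr; apply: eq_bigr => h _.
by rewrite ffunE scalerA !mulrA.
Qed.

Lemma tw_mulZr a (x y : A) : a *: tw_mul x y = tw_mul x (a *: y).
Proof.
rewrite /tw_mul scaler_sumr; apply: eq_bigr => g _.
rewrite scaler_sumr; apply: eq_bigr => h _.
by rewrite ffunE scalerA !mulrA (mulrC a).
Qed.

Lemma tw_mul0l (y : A) : tw_mul 0 y = 0.
Proof. by rewrite -[X in tw_mul X _](scale0r (0 : A)) -tw_mulZl scale0r. Qed.

Lemma tw_mul0r (x : A) : tw_mul x 0 = 0.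
Proof. by rewrite -[X in tw_mul _ X](scale0r (0 : A)) -tw_mulZr scale0r. Qed.

Lemma tw_suml (I : finType) (E : I -> A) (y : A) :
  tw_mul (\sum_i E i) y = \sum_i tw_mul (E i) y.
Proof.
exact: (big_morph (fun x => tw_mul x y)
  (fun a b => tw_mulDl a b y) (tw_mul0l y)).
Qed.

Lemma tw_sumr (I : finType) (E : I -> A) (x : A) :
  tw_mul x (\sum_i E i) = \sum_i tw_mul x (E i).
Proof. exact: (big_morph (tw_mul x) (tw_mulDr x) (tw_mul0r x)). Qed.

Lemma tw_mul_basis g h : tw_mul (u g) (u h) = f g h *: u (g * h)%g.
Proof.
rewrite /tw_mul (bigD1 g) //= [X in _ + X]big1 ?addr0; last first.
  move=> i ig; apply: big1 => j _.
  by rewrite !ffunE (negPf ig) !mul0r scale0r.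
rewrite (bigD1 h) //= big1 ?addr0; last first.
  by move=> i ih; rewrite !ffunE (negPf ih) mulr0 mul0r scale0r.
by rewrite !ffunE !eqxx !mul1r.
Qed.

Lemma tw_mulA : associative tw_mul.
Proof.
move: tw_suml tw_sumr tw_mulZl tw_mulZr tw_mul_basis.
move: tw_mul => m suml sumr mZl mZr mu x y z.
rewrite (tw_decomp x) (tw_decomp y) (tw_decomp z).
rewrite !suml; apply: eq_bigr => g _.
rewrite sumr [m _ (\sum_i y i *: _)]sumr suml; apply: eq_bigr => h _.
rewrite !sumr; apply: eq_bigr => k _.
rewrite -!(mZl, mZr) !mu -!(mZl, mZr) !mu !scalerA mulgA.
congr (_ *: _); rewrite -!mulrA [RHS]mulrCA [in RHS](mulrCA (z k)).
by rewrite cocycleP (mulrC (f h k)).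
Qed.

Lemma cocycle1l g : f 1%g g = f 1%g 1%g.
Proof.
have := cocycleP f 1 1 g; rewrite !mul1g => /eqP.
by rewrite -subr_eq0 -mulrBl mulf_eq0 (negPf (cocycle_neq0 f _ _)) orbF subr_eq0
  => /eqP.
Qed.

Lemma cocycle1r g : f g 1%g = f 1%g 1%g.
Proof.
have := cocycleP f g 1 1; rewrite !mulg1 => /eqP.
by rewrite -subr_eq0 -mulrBr mulf_eq0 (negPf (cocycle_neq0 f _ _)) /= subr_eq0
  => /eqP.
Qed.

Lemma tw_mul1r : left_id tw_one tw_mul.
Proof.
move=> x; rewrite [in LHS](tw_decomp x) [in RHS](tw_decomp x) tw_sumr.
apply: eq_bigr => g _; rewrite -tw_mulZr -tw_mulZl tw_mul_basis mul1g cocycle1l.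
by rewrite (scalerA _^-1) mulVf ?scale1r ?cocycle_neq0.
Qed.

Lemma tw_mulr1 : right_id tw_one tw_mul.
Proof.
move=> x; rewrite [in LHS](tw_decomp x) [in RHS](tw_decomp x) tw_suml.
apply: eq_bigr => g _; rewrite -tw_mulZl -tw_mulZr tw_mul_basis mulg1 cocycle1r.
by rewrite (scalerA _^-1) mulVf ?scale1r ?cocycle_neq0.
Qed.

Lemma tw_one_neq0 : tw_one != 0.
Proof.
apply/eqP => /ffunP /(_ 1%g); rewrite !ffunE eqxx /GRing.scale /= mulr1.
by move/eqP; rewrite invr_eq0 (negPf (cocycle_neq0 f _ _)).
Qed.

End TwistedGroupAlgebra.

HB.instance Definition _ (F : fieldType) (gT : finGroupType)
    (f : cocycle F gT) :=
  GRing.Zmodule_isNzRing.Build (twisted_alg f) (@tw_mulA _ _ f)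
    (@tw_mul1r _ _ f) (@tw_mulr1 _ _ f) (@tw_mulDl _ _ f) (@tw_mulDr _ _ f)
    (@tw_one_neq0 _ _ f).
HB.instance Definition _ (F : fieldType) (gT : finGroupType)
    (f : cocycle F gT) :=
  GRing.Lmodule_isLalgebra.Build F (twisted_alg f) (@tw_mulZl _ _ f).
HB.instance Definition _ (F : fieldType) (gT : finGroupType)
    (f : cocycle F gT) :=
  GRing.Lalgebra_isAlgebra.Build F (twisted_alg f) (@tw_mulZr _ _ f).

Lemma mul_tw_basis (F : fieldType) (gT : finGroupType) (f : cocycle F gT)
    (g h : gT) :
  tw_basis f g * tw_basis f h = f g h *: tw_basis f (g * h)%g.
Proof. exact: tw_mul_basis. Qed.

(* Matrix algebras of size 0 are excluded: twisted_alg f is never trivial. *)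
Definition nondegenerate (F : fieldType) (gT : finGroupType)
    (f : cocycle F gT) : Prop :=
  exists (n : nat) (phi : {lrmorphism twisted_alg f -> 'M[F]_n.+1}),
    bijective phi.

Definition central_type (F : fieldType) (gT : finGroupType) : Prop :=
  exists f : cocycle F gT, nondegenerate f.

Section SecondCohomology.
Variables (F : fieldType) (gT : finGroupType).
Implicit Types (f : cocycle F gT) (phi : [subg Aut [set: gT]]).

Definition cohomologous f1 f2 : Prop :=
  exists2 a : gT -> F, forall g, a g != 0 &
    forall g h, f2 g h = a g * a h / a (g * h)%g * f1 g h.

Lemma cohomologous_refl f : cohomologous f f.
Proof.
exists (fun=> 1) => [g|g h]; first exact: oner_neq0.
by rewrite mulr1 divr1 mul1r.
Qed.

Lemma cohomologous_sym f1 f2 : cohomologous f1 f2 -> cohomologous f2 f1.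
Proof.
move=> [a a0 E]; exists (fun g => (a g)^-1) => [g|g h].
  by rewrite invr_eq0.
have nz : a g * a h / a (g * h)%g != 0 by rewrite !mulf_neq0 ?invr_neq0.
by rewrite E -!invfM mulrA mulVf ?mul1r.
Qed.

Lemma cohomologous_trans f1 f2 f3 :
  cohomologous f1 f2 -> cohomologous f2 f3 -> cohomologous f1 f3.
Proof.
move=> [a a0 Ea] [b b0 Eb]; exists (fun g => b g * a g) => [g|g h].
  by rewrite mulf_neq0.
by rewrite Eb Ea mulrA mulf_div [(b g * b h) * _]mulrACA.
Qed.

Definition cohomologousb : rel (cocycle F gT) :=
  fun f1 f2 => `[< cohomologous f1 f2 >].

Lemma cohomologousb_refl : reflexive cohomologousb.
Proof. by move=> f; apply/asboolP; apply: cohomologous_refl. Qed.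

Lemma cohomologousb_sym : symmetric cohomologousb.
Proof.
by move=> f1 f2; apply: asbool_equiv_eq; split; apply: cohomologous_sym.
Qed.

Lemma cohomologousb_trans : transitive cohomologousb.
Proof.
move=> f2 f1 f3 /asboolP h1 /asboolP h2; apply/asboolP.
exact: cohomologous_trans h1 h2.
Qed.

Canonical cohomologous_equiv :=
  EquivRel cohomologousb cohomologousb_refl cohomologousb_sym
    cohomologousb_trans.

Definition H2 : Type := {eq_quot cohomologous_equiv}.

Definition cohomology_class f : H2 := \pi_{eq_quot cohomologous_equiv} f.

Lemma cohomology_classP f1 f2 :
  cohomology_class f1 = cohomology_class f2 <-> cohomologous f1 f2.
Proof.
by split=> [/eqmodP /asboolP //|h]; apply/eqmodP/asboolP.
Qed.

Lemma Aut_invM phi : {morph ((sgval phi)^-1)%g : g h / (g * h)%g}.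
Proof.
have /setIdP[_ /morphicP M] : ((sgval phi)^-1)%g \in Aut [set: gT].
  by rewrite groupV subgP.
by move=> g h; rewrite M ?inE.
Qed.

Fact Aut_cocycle_neq0 phi f g h :
  f (((sgval phi)^-1)%g g) (((sgval phi)^-1)%g h) != 0.
Proof. exact: cocycle_neq0. Qed.

Fact Aut_cocycle_subproof phi f g h k :
  let p := ((sgval phi)^-1)%g in
  f (p g) (p h) * f (p (g * h)%g) (p k) = f (p g) (p (h * k)%g) * f (p h) (p k).
Proof. by rewrite /= !Aut_invM cocycleP. Qed.

Definition Aut_cocycle phi f : cocycle F gT :=
  @Cocycle F gT
    (fun g h => f (((sgval phi)^-1)%g g) (((sgval phi)^-1)%g h))
    (Aut_cocycle_neq0 phi f) (Aut_cocycle_subproof phi f).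

(* The representative is irrelevant by Aut_H2E. *)
Definition Aut_H2 phi (c : H2) : H2 :=
  cohomology_class (Aut_cocycle phi (repr (c : {eq_quot cohomologous_equiv}))).

Lemma Aut_H2E phi f :
  Aut_H2 phi (cohomology_class f) = cohomology_class (Aut_cocycle phi f).
Proof.
apply/cohomology_classP.
have [a a0 E] : cohomologous
    (repr (cohomology_class f : {eq_quot cohomologous_equiv})) f.
  by apply/cohomology_classP; rewrite /cohomology_class reprK.
exists (fun g => a (((sgval phi)^-1)%g g)) => [g|g h]; first exact: a0.
by rewrite /= E Aut_invM.
Qed.

(* Permutations compose left to right, so Aut_H2 is a right action with respect
   to the group law of [subg Aut [set: gT]]; orbits do not depend on this. *)
Definition Aut_orbit (c : H2) : set H2 :=
  [set c' | exists phi, c' = Aut_H2 phi c]%classic.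

Definition nondegenerate_classes : set H2 :=
  [set c | exists2 f, nondegenerate f & c = cohomology_class f]%classic.

Definition nondegenerate_orbits : set (set H2) :=
  [set O | exists2 c, nondegenerate_classes c & O = Aut_orbit c]%classic.

End SecondCohomology.

(* Main.v *)
Require Import Defs.
From mathcomp Require Import all_boot all_order all_algebra all_fingroup.
From mathcomp Require Import reals complex.
From mathcomp Require Import ring.
From HB Require Import structures.

Set Implicit Arguments.
Unset Strict Implicit.
Unset Printing Implicit Defensive.

Import GRing.Theory Num.Theory.
Local Open Scope ring_scope.

(** The example has order 64: G = (U wr C_2) x C_2 with U elementary abelian
    of order 4, where C_2 = <t> swaps the two copies of U and the last factor
    is C_2 = <s>.

    Every nondegenerate symmetric bilinear form B : U x U -> F_2 gives a
    nondegenerate class on G. Put chi = (-1)^B. On the functions on U, let the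
    first copy of U act by the translations X^a and the second one by the
    multiplications Z^b by chi(b, -). Since B is symmetric and U has exponent
    2, the Fourier transform of chi exchanges X and Z up to scalars, so t can
    act by it: this is a projective representation of U wr C_2 of degree |U|.
    Tensoring with the two-dimensional projective representation of
    <t> x <s> by anticommuting Pauli matrices gives a projective
    representation of G of degree 2|U|, whose square is |G|. The trace of each
    nonidentity element is 0, so these operators are linearly independent and
    they identify the twisted group algebra with the full matrix algebra
    (nondegenerate_traceless, wreath_cocycle_nondegenerate).

    On U = F_2^2 there are two such forms up to isometry: the dot product,
    which has vectors with B(a, a) = 1, and the hyperbolic plane, which is
    alternating. The difference is visible in the cohomology class. Whether
    f(x, y) = f(y, x) for commuting x and y depends only on the class of f.
    For u = (a, b) in the base group and y outside the base group times <s>,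
    the commutator of u and y is (a + b, a + b), and its pairing with u is
    chi(a + b, a + b). Hence u commutes in the twisted group algebra with all
    its commutators when B is alternating (wreath_cocycle_symmetric), and this
    fails for the dot product. Automorphisms of G respect this comparison
    because enough elements of the base group can be recognised inside the
    abstract group (in_base); so the two classes are in different orbits. *)

(** * Twisted group algebras and projective representations *)

Section ProjectiveRepresentations.
Variables (F : fieldType) (gT : finGroupType).

(** The cocycle identity is associativity of matrix multiplication, read off
    at a nonzero matrix. *)
Lemma proj_rep_cocycle (n : nat) (c : gT -> gT -> F) (rho : gT -> 'M[F]_n) :
    (forall g, rho g != 0) ->
    (forall g h, rho g *m rho h = c g h *: rho (g * h)%g) ->
  forall g h k, c g h * c (g * h)%g k = c g (h * k)%g * c h k.
Proof.
move=> rho0 rhoM g h k.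
have /eqP := mulmxA (rho g) (rho h) (rho k).
rewrite !rhoM -scalemxAl -scalemxAr !rhoM !scalerA mulgA -subr_eq0 -scalerBl.
rewrite scaler_eq0 (negPf (rho0 _)) orbF subr_eq0 => /eqP <-.
by rewrite mulrC.
Qed.

Variables (f : cocycle F gT) (n : nat) (rho : gT -> 'M[F]_n.+1).
Hypothesis rhoM : forall g h, rho g *m rho h = f g h *: rho (g * h)%g.
Hypothesis rho1 : rho 1%g = (f 1%g 1%g)%:M.
Hypothesis tr_rho : forall g, g != 1%g -> \tr (rho g) = 0.
Hypothesis n_unit : n.+1%:R != 0 :> F.
Hypothesis card_n : #|gT| = (n.+1 * n.+1)%N.

(** It is declared on the plain function space, which carries a vector space
    structure with a dimension; twisted_alg f has the same elements. *)
Definition rep_alg (x : {ffun gT -> F^o}) : 'M[F]_n.+1 := \sum_g x g *: rho g.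

Fact rep_alg_linear : linear rep_alg.
Proof.
move=> a x y; rewrite /rep_alg scaler_sumr -big_split; apply: eq_bigr => g _.
by rewrite !ffunE scalerDl scalerA.
Qed.

HB.instance Definition _ :=
  GRing.isLinear.Build F {ffun gT -> F^o} 'M[F]_n.+1 *:%R rep_alg
    rep_alg_linear.

Lemma rep_alg_basis g : rep_alg (tw_basis f g) = rho g.
Proof.
rewrite /rep_alg (bigD1 g) //= big1 ?addr0 => [|h hg].
  by rewrite ffunE eqxx scale1r.
by rewrite ffunE (negPf hg) scale0r.
Qed.

(** The coordinate of x at g is recovered, up to a nonzero scalar, as the trace
    of the product of rep_alg x with rho g^-1. *)
Lemma rep_alg_inj : injective rep_alg.
Proof.
apply: raddf_inj => x x0; apply/ffunP => g; rewrite ffunE.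
have : \tr (rep_alg x *m rho g^-1%g) = 0 by rewrite x0 mul0mx mxtrace0.
rewrite /rep_alg mulmx_suml linear_sum (bigD1 g) //= big1 ?addr0.
  rewrite -scalemxAl rhoM mulgV rho1 !linearZ /= mxtrace_scalar.
  rewrite /GRing.scale /= -mulr_natr => /eqP.
  by rewrite !mulf_eq0 (negPf n_unit) !(negPf (cocycle_neq0 f _ _)) !orbF
    => /eqP.
move=> h hg; rewrite -scalemxAl rhoM !linearZ /= tr_rho ?scaler0 ?mulr0 //.
by apply: contraNneq hg => /(canRL (mulgK _)); rewrite invgK mul1g => ->.
Qed.

Lemma rep_alg_bij : bijective rep_alg.
Proof.
pose phi : 'Hom({ffun gT -> F^o}, 'M[F]_n.+1) := linfun rep_alg.
have phiE : phi =1 rep_alg by move=> x; rewrite lfunE.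
have ker0 : lker phi == 0%VS.
  by apply/lker0P => x y; rewrite !phiE; apply: rep_alg_inj.
have dimE : \dim {: {ffun gT -> F^o}} = \dim {: 'M[F]_n.+1}.
  rewrite !dimvf dim_matrix.
  exact: etrans (muln1 #|gT|) card_n.
have full : limg phi = fullv.
  apply/eqP; rewrite eqEdim subvf limg_dim_eq ?dimE //=.
  by rewrite (eqP ker0) capv0.
exists (phi^-1)%VF => x; first by rewrite -phiE lker0_lfunK.
by rewrite -phiE limg_lfunVK // full memvf.
Qed.

Fact rep_alg_monoid_morphism : monoid_morphism (rep_alg : twisted_alg f -> _).
Proof.
split=> [|x y].
  rewrite [1]/(tw_one f) /tw_one linearZ /= rep_alg_basis rho1.
  by rewrite scale_scalar_mx mulVf ?cocycle_neq0.
rewrite [x * y]/(tw_mul x y) /tw_mul linear_sum.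
transitivity ((\sum_g x g *: rho g) *m rep_alg y); last by [].
rewrite mulmx_suml.
apply: eq_bigr => g _.
rewrite linear_sum [rep_alg y]/rep_alg mulmx_sumr; apply: eq_bigr => h _.
rewrite linearZ /= rep_alg_basis -scalemxAl -scalemxAr rhoM !scalerA.
by [].
Qed.

(** A projective representation with traceless nonidentity elements and of
    degree the square root of the group order is an isomorphism onto the
    matrix algebra: it is injective, and both sides have the same dimension. *)
Lemma nondegenerate_traceless : Defs.nondegenerate f.
Proof.
pose phi : {lrmorphism twisted_alg f -> 'M[F]_n.+1} :=
  HB.pack (rep_alg : twisted_alg f -> 'M[F]_n.+1)
   (GRing.isLinear.Build F (twisted_alg f) 'M[F]_n.+1 *:%R rep_alg
      rep_alg_linear)
   (GRing.isMonoidMorphism.Build (twisted_alg f) 'M[F]_n.+1 rep_alg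
      rep_alg_monoid_morphism).
by exists n, phi; apply: rep_alg_bij.
Qed.

End ProjectiveRepresentations.

(** * The group (U wr C_2) x C_2 *)

Section WreathProduct.
Variable U : finZmodType.

(** An element ((a, b), (t, s)) is the product of (a, b) in the base group
    U x U, of the t-th power of the swap and of the s-th power of the
    generator of the extra factor C_2. *)
Definition wreath : Type := (U * U * (bool * bool))%type.
HB.instance Definition _ := Finite.on wreath.

Definition swap (t : bool) (n : U * U) : U * U := if t then (n.2, n.1) else n.

Definition wreath_mul (g h : wreath) : wreath :=
  (g.1 + swap g.2.1 h.1, (g.2.1 (+) h.2.1, g.2.2 (+) h.2.2)).
Definition wreath_one : wreath := ((0, 0), (false, false)).
Definition wreath_inv (g : wreath) : wreath := (- swap g.2.1 g.1, g.2).

Lemma swapD t (m n : U * U) : swap t (m + n) = swap t m + swap t n.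
Proof. by case: t m n => [] [a b] [c d]. Qed.

Lemma swap_addb t t' (n : U * U) : swap t (swap t' n) = swap (t (+) t') n.
Proof. by case: t t' n => [] [] []. Qed.

Fact wreath_mulA : associative wreath_mul.
Proof.
move=> [m [t s]] [n [t' s']] [p [t'' s'']].
by rewrite /wreath_mul /= !addbA swapD swap_addb addrA.
Qed.

Fact wreath_mul1 : left_id wreath_one wreath_mul.
Proof. by move=> [[a b] [t s]]; rewrite /wreath_mul /= add0r. Qed.

Fact wreath_mulV : left_inverse wreath_one wreath_inv wreath_mul.
Proof.
move=> [[a b] [t s]]; rewrite /wreath_mul /= !addbb.
by case: t; rewrite /= addNr.
Qed.

HB.instance Definition _ :=
  Finite_isGroup.Build wreath wreath_mulA wreath_mul1 wreath_mulV.

Lemma wreath_mulE (a b a' b' : U) (t s t' s' : bool) :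
  ((((a, b), (t, s)) : wreath) * (((a', b'), (t', s')) : wreath))%g =
  ((if t then (a + b', b + a') else (a + a', b + b')), (t (+) t', s (+) s')).
Proof. by case: t. Qed.

Lemma card_wreath : #|{: wreath}| = (#|U| * 2 * (#|U| * 2))%N.
Proof. by rewrite !card_prod card_bool mulnACA. Qed.

End WreathProduct.

(** * The nondegenerate class attached to a symmetric form *)

Section HeisenbergWeil.
Variables (F : numFieldType) (U : finZmodType) (B : U -> U -> bool).
Hypothesis B_addl : forall a b c, B (a + b) c = B a c (+) B b c.
Hypothesis B_sym : forall a b, B a b = B b a.
Hypothesis B_nondeg : forall a, a != 0 -> exists c, B a c.
Local Notation G := (wreath U).

Definition chi (a b : U) : F := (-1) ^+ B a b.

Lemma B_addr a b c : B c (a + b) = B c a (+) B c b.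
Proof. by rewrite ![B c _]B_sym B_addl. Qed.

Lemma chi_addl a b c : chi (a + b) c = chi a c * chi b c.
Proof. by rewrite /chi B_addl signr_addb. Qed.

Lemma chi_addr a b c : chi c (a + b) = chi c a * chi c b.
Proof. by rewrite /chi B_addr signr_addb. Qed.

Lemma chi_sym a b : chi a b = chi b a.
Proof. by rewrite /chi B_sym. Qed.

Lemma chi_neq0 a b : chi a b != 0.
Proof. by rewrite /chi signr_eq0. Qed.

Lemma chi_sq a b : chi a b * chi a b = 1.
Proof. by rewrite -signr_addb addbb. Qed.

Lemma B_0r a : B a 0 = false.
Proof. by have := B_addr 0 0 a; rewrite addr0 addbb. Qed.

Lemma chi_0r a : chi a 0 = 1.
Proof. by rewrite /chi B_0r. Qed.

(** Values of B are bits, so B(a + a, c) = 0 for all c. *)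
Lemma addrr_U (a : U) : a + a = 0.
Proof.
apply/eqP; apply: contraT => /B_nondeg [c].
by rewrite B_addl addbb.
Qed.

Lemma opp_U (a : U) : - a = a.
Proof. by apply/esym/eqP; rewrite -addr_eq0 addrr_U. Qed.

Lemma eq_addU (x y a : U) : (x == y + a) = (y == x + a).
Proof. by rewrite -subr_eq opp_U eq_sym. Qed.

(** Translating by an element c with B(b, c) = 1 changes the sign of the
    sum when b is nonzero. *)
Lemma sum_chi b : \sum_x chi x b = if b == 0 then #|U|%:R else 0.
Proof.
case: eqVneq => [-> | /B_nondeg [c Bbc]].
  under eq_bigr do rewrite chi_0r.
  by rewrite sumr_const.
set S := \sum_x _; have : S = - S.
  rewrite {1}/S (reindex_inj (addIr c)) -sumrN; apply: eq_bigr => x _.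
  by rewrite chi_addl {2}/chi B_sym Bbc mulrN1.
by move/eqP; rewrite -subr_eq0 opprK -mulr2n mulrn_eq0 => /eqP.
Qed.

(** The kernel of the operator X^a Z^b F^t on functions on U, for n = (a, b):
    X^a is translation by a, Z^b is multiplication by chi b, and F is the
    Fourier transform, with kernel chi. The Fourier transform is left
    unnormalised, so its square is |U|. *)
Definition heis (n : U * U) (t : bool) (x y : U) : F :=
  if t then chi (x + n.1) (n.2 + y) else (y == x + n.1)%:R * chi (x + n.1) n.2.

(** The entries of P^t Q^s, where P exchanges the two basis vectors and Q is
    the diagonal matrix with entries 1 and -1. *)
Definition pauli (t s i j : bool) : F := (j == i (+) t)%:R * (-1) ^+ (s && j).

(** The scalar needed to bring X^a Z^b F^t X^a' Z^b' F^t' to the form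
    X^a'' Z^b'' F^t'': it moves Z^b past X^a' if t = 0. If t = 1, moving F to
    the right turns X^a' Z^b' into Z^a' X^b', then X^b' moves to the left past
    Z^b Z^a', and F F contributes |U|. *)
Definition heis_cocycle (n : U * U) (t : bool) (n' : U * U) (t' : bool) : F :=
  if t then chi n'.2 n.2 * chi n'.2 n'.1 * (if t' then #|U|%:R else 1)
  else chi n'.1 n.2.

Definition wreath_cocycle (g h : G) : F :=
  heis_cocycle g.1 g.2.1 h.1 h.2.1 * (-1) ^+ (g.2.2 && h.2.1).

Lemma sum_delta (T : finType) (E : T -> F) a :
  \sum_y (y == a)%:R * E y = E a.
Proof.
rewrite (bigD1 a) //= eqxx mul1r big1 ?addr0 // => y /negPf ->.
by rewrite mul0r.
Qed.

Lemma heisM n t n' t' x z :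
  \sum_y heis n t x y * heis n' t' y z =
    heis_cocycle n t n' t' * heis (n + swap t n') (t (+) t') x z.
Proof.
case: n n' => [a b] [a' b']; rewrite /heis /heis_cocycle.
case: t t' => [] [] /=.
(* F meets F: the sum over y is a character sum. *)
- transitivity (\sum_y chi y (x + a + b' + z) *
    (chi x b * chi a b * chi a' b' * chi a' z)).
    apply: eq_bigr => y _; rewrite !(chi_addr, chi_addl).
    by rewrite (chi_sym y x) (chi_sym y a); ring.
  rewrite -mulr_suml sum_chi.
  have -> : (x + a + b' + z == 0) = (z == x + a + b').
    by rewrite addr_eq0 opp_U eq_sym.
  rewrite (addrA x); case: eqVneq => [-> | _]; last by rewrite !mul0r mulr0.
  rewrite mul1r !(chi_addr, chi_addl) !(chi_sym a' _).
  transitivity (#|U|%:R * (chi x b * chi a b * chi x a' * chi a a') *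
    (chi b' a' * chi b' a')); first by ring.
  transitivity (#|U|%:R * (chi x b * chi a b * chi x a' * chi a a') *
    (chi b' b * chi b' b) * (chi b' a' * chi b' a')); last by ring.
  by rewrite !chi_sq; ring.
(* From here on a translation selects the single term y = z + a', resp.
   y = x + a; the remaining discrepancies are squares of values of chi. *)
- transitivity (\sum_y (y == z + a')%:R *
    (chi (x + a) (b + y) * chi (y + a') b')).
    by apply: eq_bigr => y _; rewrite (eq_addU z) mulrCA.
  rewrite sum_delta -[z + a' + a']addrA addrr_U addr0.
  rewrite !(chi_addr, chi_addl) (chi_sym z).
  transitivity (chi x b * chi x z * chi x a' * chi a b * chi a z * chi a a' *
    chi b' z * (chi b' b * chi b' b) * (chi b' a' * chi b' a')); last by ring.
  by rewrite !chi_sq; ring.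
- transitivity (\sum_y (y == x + a)%:R *
    (chi (x + a) b * chi (y + a') (b' + z))).
    by apply: eq_bigr => y _; rewrite -!mulrA.
  rewrite sum_delta !(chi_addr, chi_addl).
  transitivity (chi x b * chi a b * (chi x b' * chi a b' * chi a' b') *
    (chi x z * chi a z * chi a' z) * (chi a' b * chi a' b)); last by ring.
  by rewrite chi_sq; ring.
- transitivity (\sum_y (y == x + a)%:R *
    (chi (x + a) b * ((z == y + a')%:R * chi (y + a') b'))).
    by apply: eq_bigr => y _; rewrite -!mulrA.
  rewrite sum_delta addrA !(chi_addr, chi_addl).
  transitivity ((z == x + a + a')%:R * (chi x b * chi a b * chi x b' *
    chi a b' * chi a' b') * (chi a' b * chi a' b)); last by ring.
  by rewrite chi_sq; ring.
Qed.

Lemma pauliM t s t' s' i k :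
  \sum_j pauli t s i j * pauli t' s' j k =
    (-1) ^+ (s && t') * pauli (t (+) t') (s (+) s') i k.
Proof.
by rewrite big_bool /pauli; case: t t' s s' i k => [] [] [] [] [] [];
  rewrite /= ?expr0 ?expr1 ?(mulr1, mul1r, mulr0, mul0r, addr0, add0r, mulrNN).
Qed.

Definition wreath_kernel (g : G) (x y : U * bool) : F :=
  heis g.1 g.2.1 x.1 y.1 * pauli g.2.1 g.2.2 x.2 y.2.

Lemma wreath_kernelM g h x z :
  \sum_y wreath_kernel g x y * wreath_kernel h y z =
    wreath_cocycle g h * wreath_kernel (g * h)%g x z.
Proof.
case: g h x z => [m [t s]] [n [t' s']] [x i] [z k].
transitivity ((\sum_y heis m t x y * heis n t' y z) *
  (\sum_j pauli t s i j * pauli t' s' j k)).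
  rewrite big_distrlr /= pair_bigA; apply: eq_bigr => -[y j] _ /=.
  exact: mulrACA.
by rewrite heisM pauliM mulrACA.
Qed.

Lemma wreath_kernel1 x y : wreath_kernel 1%g x y = (x == y)%:R.
Proof.
case: x y => [x i] [y j]; rewrite /wreath_kernel /heis /pauli /=.
rewrite addr0 chi_0r expr0 !mulr1 -natrM mulnb -xpair_eqE.
by rewrite [(y, j) == _]eq_sym; case: i.
Qed.

(** For t = 1 the Pauli factor has zero diagonal; for t = 0 and s = 1 its
    trace is 1 - 1. For t = s = 0 the trace of X^a Z^b vanishes because
    translation by a nonzero a has no fixed point, and, if a = 0, by sum_chi. *)
Lemma wreath_kernel_trace g : g != 1%g -> \sum_x wreath_kernel g x x = 0.
Proof.
case: g => [[a b] [t s]] g1.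
transitivity ((\sum_x heis (a, b) t x x) * (\sum_i pauli t s i i)).
  by rewrite big_distrlr /= pair_bigA.
rewrite big_bool /pauli /heis /=.
case: t g1 => g1; first by rewrite !mul0r addr0 mulr0.
rewrite /= !mul1r andbF andbT expr0.
case: s g1 => g1; first by rewrite expr1 addNr mulr0.
suff -> : \sum_x (x == x + a)%:R * chi (x + a) b = 0 by rewrite mul0r.
case: (eqVneq a 0) => [a0 | a0].
  transitivity (\sum_x chi x b).
    by apply: eq_bigr => x _; rewrite a0 addr0 eqxx mul1r.
  by rewrite sum_chi ifN //; apply: contraNneq g1 => b0; rewrite a0 b0.
apply: big1 => x _; rewrite -[X in X == _]addr0 (inj_eq (addrI x)) eq_sym.
by rewrite (negPf a0) mul0r.
Qed.

Lemma wreath_cocycle_neq0 g h : wreath_cocycle g h != 0.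
Proof.
rewrite mulf_neq0 ?signr_eq0 // /heis_cocycle.
have U0 : #|U|%:R != 0 :> F.
  by rewrite pnatr_eq0 -lt0n; apply/card_gt0P; exists 0.
by case: g.2.1; rewrite ?mulf_neq0 ?chi_neq0 //; case: ifP; rewrite ?oner_neq0.
Qed.

Definition kernel_mx n (e : 'I_n -> U * bool) (g : G) : 'M[F]_n :=
  \matrix_(i, j) wreath_kernel g (e i) (e j).

Lemma wreath_cocycle_nondegenerate :
  exists2 f : cocycle F G, f =2 wreath_cocycle & Defs.nondegenerate f.
Proof.
have /card_gt0P : exists x, x \in {: U * bool} by exists (0, false).
case En: #|{: U * bool}| => [//|n] _.
pose e (i : 'I_n.+1) : U * bool := enum_val (cast_ord (esym En) i).
have e_inj : injective e by move=> i j /enum_val_inj /cast_ord_inj.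
have e_bij : bijective e by apply: inj_card_bij; rewrite ?card_ord ?En.
have sum_e (E : U * bool -> F) : \sum_i E (e i) = \sum_x E x.
  by rewrite [RHS](reindex e) //; apply: onW_bij.
pose rho := kernel_mx e.
have rhoM g h : rho g *m rho h = wreath_cocycle g h *: rho (g * h)%g.
  apply/matrixP => i j; rewrite !mxE -wreath_kernelM -sum_e.
  by apply: eq_bigr => k _; rewrite !mxE.
have rho1 : rho 1%g = 1%:M.
  by apply/matrixP => i j; rewrite !mxE wreath_kernel1 (inj_eq e_inj).
have wc1 : wreath_cocycle 1%g 1%g = 1.
  by rewrite /wreath_cocycle /= chi_0r mulr1.
have rho0 g : rho g != 0.
  apply/eqP => g0; have := rhoM g g^-1%g.
  rewrite g0 mul0mx mulgV => /esym/eqP; rewrite scaler_eq0.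
  rewrite (negPf (wreath_cocycle_neq0 _ _)) rho1 => /eqP/matrixP/(_ 0 0).
  by rewrite !mxE eqxx => /eqP; rewrite oner_eq0.
pose f := Cocycle wreath_cocycle_neq0 (proj_rep_cocycle rho0 rhoM).
exists f => //; apply: (@nondegenerate_traceless _ _ f n rho) => //.
- by rewrite rho1 /= wc1.
- move=> g g1; rewrite /mxtrace -[RHS](wreath_kernel_trace g1) -sum_e.
  by apply: eq_bigr => i _; rewrite mxE.
- by rewrite pnatr_eq0.
- by rewrite card_wreath -En card_prod card_bool.
Qed.

(** Here c is the commutator of g and y, characterised without inverses. If
    y swaps the two copies of U then c = (a + b, a + b) for g = (a, b), and the
    commutation scalar of g and c is chi (a + b) (a + b); otherwise c = 1. *)
Lemma wreath_cocycle_symmetric (g y c : G) :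
    (forall a, ~~ B a a) -> g.2.1 = false -> (g * y = y * g * c)%g ->
  wreath_cocycle g c = wreath_cocycle c g.
Proof.
move=> B_alt; case: g y c => [[a b] [t s]] [[p q] [t' s']] [[c d] [t'' s'']].
rewrite /= => ->; rewrite !wreath_mulE /wreath_cocycle /heis_cocycle /= andbF.
have chi_alt x : chi x x = 1 by rewrite /chi (negPf (B_alt x)).
case: t' => -[] E1 E2 Et _; (have {Et}-> : t'' = false by case: t'' Et);
  rewrite andbF; last first.
  have -> : c = 0 by apply: (addrI (p + a)); rewrite -E1 addr0 addrC.
  have -> : d = 0 by apply: (addrI (q + b)); rewrite -E2 addr0 addrC.
  by rewrite chi_sym !chi_0r.
have -> : d = a + b.
  by apply: (addrI (p + b)); rewrite -E1 addrACA addrr_U addr0 addrC.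
have -> : c = b + a.
  by apply: (addrI (q + a)); rewrite -E2 addrACA addrr_U addr0 addrC.
by rewrite chi_addl chi_addr !chi_alt mul1r mulr1 chi_sym.
Qed.

End HeisenbergWeil.

(** * Two orbits *)

Section BaseGroup.
Variable U : finZmodType.
Implicit Types g h w y z : wreath U.

(** Commuting with an element that swaps forces h to have the form
    ((p, p), (false, r)). *)
Lemma base_center g h y : g.2.1 -> ~~ h.2.1 -> (g * h = h * g)%g ->
  (h * y = y * h)%g.
Proof.
case: g h y => [[a b] [t s]] [[p q] [t' s']] [[x y] [t'' s'']] /= -> /negPf->.
rewrite !wreath_mulE /= => -[E1 _ _]; have -> : p = q.
  by apply: (addIr a); rewrite -E1 addrC.
by case: t''; rewrite ?addbF /= ?(addrC q) ?(addbC s').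
Qed.

(** A criterion stable under automorphisms for g to lie in U x U x <s>: if g
    involved the swap, then w, or else g w, would be an element of
    U x U x <s> commuting with g, hence central. *)
Lemma in_base g w y z : (g * w = w * g)%g -> (w * y != y * w)%g ->
  ((g * w) * z != z * (g * w))%g -> g.2.1 = false.
Proof.
move=> gw wy gwz; apply/negbTE/negP => gt.
have [wt | /negP wt] := boolP w.2.1.
  move/negP: gwz; apply; apply/eqP; apply: (base_center _ gt).
    by case: g w gt wt {gw wy} => [? [? ?]] [? [? ?]] /= -> ->.
  by rewrite -mulgA -gw.
by move/negP: wy; apply; apply/eqP; apply: (base_center _ gt) => //; apply/negP.
Qed.

End BaseGroup.

Section Orbits.
Variables (F : fieldType) (gT : finGroupType).
Implicit Types f : cocycle F gT.

(** A coboundary is symmetric on commuting pairs. *)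
Lemma cohomologous_symmetric f f' x y : cohomologous f f' ->
  (x * y = y * x)%g -> f x y = f y x -> f' x y = f' y x.
Proof. by move=> [a _ E] xy fxy; rewrite !E fxy xy (mulrC (a x)). Qed.

Lemma Aut_orbit_class f :
  Aut_orbit (cohomology_class f) (cohomology_class f).
Proof.
exists 1%g; rewrite Aut_H2E; apply/cohomology_classP.
exists (fun=> 1) => [g|g h].
  exact: oner_neq0.
by rewrite /= invg1 !perm1 mulr1 divr1 mul1r.
Qed.

End Orbits.

(** The test triple is the base element (u, 0), the swap y and their
    commutator (u, u), whose commutation scalar for B1 is chi u u = -1. An
    automorphism keeps (u, 0) in U x U x <s> by in_base, with companion (w, 0),
    so for B2 the corresponding scalar is 1. *)
Lemma wreath_classes_not_conjugate (F : numFieldType) (U : finZmodType)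
    (B1 B2 : U -> U -> bool) (f1 f2 : cocycle F (wreath U)) (u w : U) phi :
    (forall a b c, B1 (a + b) c = B1 a c (+) B1 b c) ->
    (forall a b c, B2 (a + b) c = B2 a c (+) B2 b c) ->
    (forall a b, B1 a b = B1 b a) -> (forall a b, B2 a b = B2 b a) ->
    (forall a, a != 0 -> exists c, B2 a c) ->
    f1 =2 wreath_cocycle F B1 -> f2 =2 wreath_cocycle F B2 ->
    B1 u u -> (forall a, ~~ B2 a a) -> w != 0 -> w != u ->
  cohomology_class f1 <> Aut_H2 phi (cohomology_class f2).
Proof.
move=> B1l B2l B1s B2s B2n E1 E2 B1u B2a w0 wu; rewrite Aut_H2E.
move=> /cohomology_classP /cohomologous_sym coh.
set p : {perm wreath U} := ((sgval phi)^-1)%g.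
have pM : {morph p : g h / (g * h)%g} := Aut_invM phi.
have U2 := addrr_U B2l B2n.
pose b (a : U) : wreath U := ((a, 0), (false, false)).
pose y : wreath U := ((0, 0), (true, false)).
pose c : wreath U := ((u, u), (false, false)).
have bM x z : (b x * b z = b (x + z))%g by rewrite /b wreath_mulE /= addr0.
have by_neq x : x != 0 -> (p (b x) * p y != p y * p (b x))%g.
  move=> x0; rewrite -!pM (inj_eq perm_inj) !wreath_mulE /= !addr0.
  by rewrite xpair_eqE /= xpair_eqE /= (negPf x0).
have buw : (p (b u) * p (b w) = p (b w) * p (b u))%g.
  by rewrite -!pM !bM addrC.
have base_u : (p (b u)).2.1 = false.
  apply: (in_base buw (by_neq w w0)).
  rewrite -pM bM; apply: (by_neq (u + w)).
  by rewrite addr_eq0 (opp_U B2l B2n) eq_sym.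
have sym2 : f2 (p (b u)) (p c) = f2 (p c) (p (b u)).
  rewrite !E2; apply: (@wreath_cocycle_symmetric _ _ _ _ _ _ _ (p y)) => //.
  rewrite -!pM; congr (p _); rewrite !wreath_mulE /= !add0r.
  by rewrite U2 addr0.
have bc : (b u * c = c * b u)%g by rewrite !wreath_mulE /= addr0 add0r.
have := cohomologous_symmetric coh bc sym2.
rewrite !E1 /wreath_cocycle /heis_cocycle /= !mulr1 /chi B1u.
have -> : B1 u 0 = false by rewrite (B_0r B1l).
rewrite expr1 expr0 => /eqP.
by rewrite -subr_eq0 opprK -mulr2n pnatr_eq0.
Qed.

(** The vector space of dimension 2 over the field with two elements. *)
Definition plane : Type := (bool * bool)%type.
HB.instance Definition _ := GRing.Zmodule.on plane.
HB.instance Definition _ := Finite.on plane.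

Definition dot (a b : plane) : bool := (a.1 && b.1) (+) (a.2 && b.2).
Definition hyperbolic (a b : plane) : bool := (a.1 && b.2) (+) (a.2 && b.1).

Lemma dot_addl a b c : dot (a + b) c = dot a c (+) dot b c.
Proof. by case: a b c => [[] []] [[] []] [[] []]. Qed.

Lemma dot_sym a b : dot a b = dot b a.
Proof. by case: a b => [[] []] [[] []]. Qed.

Lemma dot_nondeg a : a != 0 -> exists c, dot a c.
Proof.
by case: a => [[] b] // a0; [exists (true, false) | exists (false, true)];
  case: b a0.
Qed.

Lemma hyperbolic_addl a b c :
  hyperbolic (a + b) c = hyperbolic a c (+) hyperbolic b c.
Proof. by case: a b c => [[] []] [[] []] [[] []]. Qed.

Lemma hyperbolic_sym a b : hyperbolic a b = hyperbolic b a.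
Proof. by case: a b => [[] []] [[] []]. Qed.

Lemma hyperbolic_nondeg a : a != 0 -> exists c, hyperbolic a c.
Proof.
by case: a => [[] b] // a0; [exists (false, true) | exists (true, false)];
  case: b a0.
Qed.

Lemma hyperbolic_alt a : ~~ hyperbolic a a.
Proof. by case: a => [[] []]. Qed.

Theorem mainTheorem5 (R : realType) :
  exists gT : finGroupType,
    central_type R[i] gT /\
    exists O1 O2 : classical_sets.set (H2 R[i] gT),
      nondegenerate_orbits O1 /\
      nondegenerate_orbits O2 /\
      O1 <> O2.
Proof.
have [f1 E1 nd1] :=
  wreath_cocycle_nondegenerate R[i] dot_addl dot_sym dot_nondeg.
have [f2 E2 nd2] := wreath_cocycle_nondegenerate R[i]
  hyperbolic_addl hyperbolic_sym hyperbolic_nondeg.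
exists (wreath plane); split; first by exists f1.
exists (Aut_orbit (cohomology_class f1)), (Aut_orbit (cohomology_class f2)).
split; first by exists (cohomology_class f1) => //; exists f1.
split; first by exists (cohomology_class f2) => //; exists f2.
move=> eqO; have := Aut_orbit_class f1; rewrite eqO => -[phi].
exact: (wreath_classes_not_conjugate (u := (true, false) : plane)
  (w := (false, true) : plane) dot_addl hyperbolic_addl dot_sym hyperbolic_sym
  hyperbolic_nondeg E1 E2 isT hyperbolic_alt isT isT).
Qed.
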